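(* Let $d,m\geq1$ be integers. The cardinality of $NC(d,m)$ is less than $(4d+4)^{2m}$. Moreover, for any $\pi\in NC(d,m)$ the number of blocks of $\pi$ of size $2$ is greater than $(d-2)m$.
   Context: $[2dm]=\{1,\dots,2dm\}$ is divided into $2m$ intervals $J_k=\{(k-1)d+1,\dots,kd\}$, $1\leq k\leq2m$. $NC(d,m)$ is the set of non-crossing partitions $\pi$ of $[2dm]$ all of whose blocks have even cardinality and that connect only elements of different intervals $J_k$, i.e. no two distinct elements of a same $J_k$ lie in the same block of $\pi$. *)

(* Defs.v *)
From mathcomp Require Import all_boot.

Set Implicit Arguments.
Unset Strict Implicit.
Unset Printing Implicit Defensive.

(* The ground set {1, ..., 2dm} is represented by 'I_(2 * d * m), with i
   standing for i + 1; likewise k : 'I_(2 * m) stands for the index k + 1. *)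

Definition J (d m : nat) (k : 'I_(2 * m)) : {set 'I_(2 * d * m)} :=
  [set i : 'I_(2 * d * m) | k * d <= i < k.+1 * d].

Definition noncrossing (n : nat) (P : {set {set 'I_n}}) : bool :=
  [forall A in P, forall B in P, (A != B) ==>
     ~~ [exists a in A, exists b in B, exists a' in A, exists b' in B,
           [&& a < b, b < a' & a' < b']]].

Definition even_blocks (n : nat) (P : {set {set 'I_n}}) : bool :=
  [forall B in P, ~~ odd #|B|].

Definition connects_different_intervals (d m : nat)
    (P : {set {set 'I_(2 * d * m)}}) : bool :=
  [forall B in P, forall k : 'I_(2 * m),
     forall i in J d k, forall j in J d k,
       (i != j) ==> ~~ ((i \in B) && (j \in B))].

Definition NC (d m : nat) : {set {set {set 'I_(2 * d * m)}}} :=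
  [set P | [&& partition P [set: 'I_(2 * d * m)],
               noncrossing P,
               even_blocks P
             & connects_different_intervals P]].

(* Main.v *)
Require Import Defs.
From mathcomp Require Import all_boot all_order all_algebra.
From mathcomp Require Import zify.

Set Implicit Arguments.
Unset Strict Implicit.
Unset Printing Implicit Defensive.

(** Call a point early if it is not the least element of its block, and late if
    it is not the greatest.  The key fact ([early_le_late]) is that within one
    interval an early point never lies after a different late point: if [x < y]
    lie in the same interval, [x] late and [y] early, then a point of the block
    of [y] before the interval, [x], [y] and a point of the block of [x] after
    the interval form a crossing.

    Pairs.  By the key fact an interval contains at most one interior point
    (both early and late), and the first interval contains none, so there are at
    most [2m - 1] interior points.  A block has at most two points that are not
    interior, so an even block [B] other than a pair satisfies [|B| <= 2 i(B)],
    where [i(B)] is the number of its interior points.  Summing over the blocks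
    gives [2dm <= 2p + 2(2m - 1)] for the number [p] of pairs, hence
    [p > (d - 2)m].

    Cardinality.  A noncrossing partition is determined by its sets of early and
    late points ([noncrossing_eq]): scanning from left to right, an early point
    joins the open block visited most recently.  As all blocks have at least two
    elements, each point is early or late; by the key fact the early points of an
    interval form an initial segment of it, and only the last of them can be
    late.  So in each interval the two sets are known from the number of early
    points and one bit saying whether there is an interior point.  This leaves
    at most [(2(d + 1))^(2m)] partitions. *)

(** * Early and late points of a noncrossing partition *)

Section EarlyLate.

Variable n : nat.
Implicit Types (P Q : {set {set 'I_n}}) (x y : 'I_n).

(** [x] is preceded by another element of its block. *)
Definition early P x := [exists y : 'I_n, (y < x) && (pblock P y == pblock P x)].

(** [x] is followed by another element of its block. *)
Definition late P x := [exists y : 'I_n, (x < y) && (pblock P y == pblock P x)].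

Lemma mem_pblockT P x : partition P [set: 'I_n] -> x \in pblock P x.
Proof. by move=> pP; rewrite mem_pblock (cover_partition pP) inE. Qed.

Lemma pblock_memT P x : partition P [set: 'I_n] -> pblock P x \in P.
Proof. by move=> pP; rewrite pblock_mem // (cover_partition pP) inE. Qed.

Lemma eq_pblockT P x y : partition P [set: 'I_n] ->
  (pblock P x == pblock P y) = (y \in pblock P x).
Proof.
move=> pP; apply: eq_pblock; last by rewrite (cover_partition pP) inE.
by case/and3P: pP.
Qed.

Lemma noncrossing_pblock P (a b a' b' : 'I_n) :
    partition P [set: 'I_n] -> noncrossing P -> a < b -> b < a' -> a' < b' ->
    pblock P a = pblock P a' -> pblock P b = pblock P b' ->
  pblock P a = pblock P b.
Proof.
move=> pP /forall_inP ncP ab ba' a'b' eqa eqb; apply/eqP/negP => /negP neq.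
have /forall_inP/(_ _ (pblock_memT b pP)) := ncP _ (pblock_memT a pP).
rewrite neq /= => /negP; apply.
apply/exists_inP; exists a; first exact: mem_pblockT.
apply/exists_inP; exists b; first exact: mem_pblockT.
apply/exists_inP; exists a'; first by rewrite eqa mem_pblockT.
apply/exists_inP; exists b'; first by rewrite eqb mem_pblockT.
by rewrite ab ba' a'b'.
Qed.

Lemma even_early_or_late P x :
  partition P [set: 'I_n] -> even_blocks P -> early P x || late P x.
Proof.
move=> pP /forall_inP/(_ _ (pblock_memT x pP)).
rewrite (cardsD1 x) mem_pblockT //=.
have [->|[y]] := set_0Vmem (pblock P x :\ x); first by rewrite cards0.
rewrite !inE -eq_pblockT // eq_sym => /andP[yx /eqP eqP] _.
have [lt|lt|/val_inj eq] := ltngtP y x; last by rewrite eq eqxx in yx.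
- by apply/orP; left; apply/existsP; exists y; rewrite lt eqP eqxx.
- by apply/orP; right; apply/existsP; exists y; rewrite lt eqP eqxx.
Qed.

(** [y] is the immediate predecessor of [x] in its block. *)
Definition block_pred P x y :=
  [/\ y < x, pblock P y = pblock P x &
    forall z : 'I_n, y < z -> z < x -> pblock P z <> pblock P x].

Lemma early_pred P x : early P x -> exists y, block_pred P x y.
Proof.
case/existsP => y0 Py0.
case: (@arg_maxnP _ y0 (fun y => (y < x) && (pblock P y == pblock P x))
         (fun y => y : nat) Py0) => y /andP[yx /eqP eqy] ymax.
exists y; split=> // z yz zx eqz.
by have := ymax z; rewrite zx eqz eqxx => /(_ isT); rewrite /= leqNgt yz.
Qed.

(** The predecessor of [x] for [P] is the greatest point that is the last before
    [x] of a block of [P] having a point at or after [x].  If [Q] agrees with [P]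
    before [x] and has the same late points, then the predecessor of [x] for [Q]
    is also the last point before [x] of such a block of [P]. *)
Lemma block_pred_le P Q x y y' :
    partition P [set: 'I_n] -> noncrossing P -> late P =1 late Q ->
    (forall u v : 'I_n, u < x -> v < x ->
       (pblock P u == pblock P v) = (pblock Q u == pblock Q v)) ->
    block_pred P x y -> block_pred Q x y' ->
  y' <= y.
Proof.
move=> pP ncP eqR agree [yx eqy last_y] [y'x eqy' last_y'].
rewrite leqNgt; apply/negP => yy'.
have : late P y'.
  by rewrite eqR; apply/existsP; exists x; rewrite y'x eqy' eqxx.
case/existsP => w /andP[y'w /eqP eqw].
have xw : x <= w.
  rewrite leqNgt; apply/negP => wx; apply: (last_y' w) => //.
  by move/eqP: eqw; rewrite agree // => /eqP ->.
apply: (last_y y') => //; rewrite -eqy.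
move: xw; rewrite leq_eqVlt => /predU1P[/val_inj xw|xw].
  by rewrite eqy -eqw -xw.
by apply/esym; apply: (@noncrossing_pblock P y y' x w).
Qed.

Lemma block_pred_agree P Q x y (u : 'I_n) :
    (forall u v : 'I_n, u < x -> v < x ->
       (pblock P u == pblock P v) = (pblock Q u == pblock Q v)) ->
    block_pred P x y -> block_pred Q x y -> u < x ->
  (pblock P u == pblock P x) = (pblock Q u == pblock Q x).
Proof. by move=> agree [yx <- _] [_ <- _] ux; apply: agree. Qed.

Lemma noncrossing_eq P Q :
    partition P [set: 'I_n] -> partition Q [set: 'I_n] ->
    noncrossing P -> noncrossing Q ->
    early P =1 early Q -> late P =1 late Q ->
  P = Q.
Proof.
move=> pP pQ ncP ncQ eqL eqR.
have agree k (u v : 'I_n) : u < k -> v < k ->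
    (pblock P u == pblock P v) = (pblock Q u == pblock Q v).
  elim: k u v => // k IH u v.
  (* by symmetry it is enough to compare with the last point [v = k] *)
  have step (x a : 'I_n) : x = k :> nat -> a < x ->
      (pblock P a == pblock P x) = (pblock Q a == pblock Q x).
    move=> xk ax; rewrite -xk in IH.
    have [Lx|nLx] := boolP (early P x).
      have [y yP] := early_pred Lx.
      have := Lx; rewrite eqL => /early_pred[y' yQ].
      have eqyy' : y = y'.
        apply/val_inj/anti_leq; apply/andP; split.
        - by apply: (@block_pred_le Q P x) => // *; rewrite IH.
        - exact: (@block_pred_le P Q x).
      by rewrite -eqyy' in yQ; apply: (block_pred_agree IH yP yQ).
    have nLx' := nLx; rewrite eqL in nLx'.
    transitivity false; [apply/negP|apply/esym/negP] => eqa.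
    - by case/existsP: nLx; exists a; rewrite ax eqa.
    - by case/existsP: nLx'; exists a; rewrite ax eqa.
  rewrite !ltnS leq_eqVlt => /predU1P[uk|uk].
    rewrite leq_eqVlt => /predU1P[vk|vk].
      by have -> : u = v by [apply: val_inj; rewrite /= uk vk]; rewrite !eqxx.
    by rewrite eq_sym [RHS]eq_sym; apply: step => //; rewrite uk.
  rewrite leq_eqVlt => /predU1P[vk|vk]; last exact: IH.
  by apply: step => //; rewrite vk.
rewrite -(equivalence_partition_pblock pP) -(equivalence_partition_pblock pQ).
apply: eq_in_imset => x _; apply/setP => y; rewrite !inE /=.
by rewrite -!eq_pblockT //; apply: (agree n).
Qed.

(** The points that are neither the least nor the greatest of their block. *)
Definition interior_points P := [set x | early P x && late P x].

Lemma card_block_noninterior P B :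
  partition P [set: 'I_n] -> B \in P -> #|B :\: interior_points P| <= 2.
Proof.
move=> pP BP.
have eqB x : x \in B -> pblock P x = B.
  by move=> xB; apply: def_pblock => //; case/and3P: pP.
have sub : B :\: interior_points P \subset
    (B :&: [set x | ~~ early P x]) :|: (B :&: [set x | ~~ late P x]).
  by apply/subsetP => x; rewrite !inE negb_and => /andP[/orP[] -> ->]; rewrite ?orbT.
apply: leq_trans (subset_leq_card sub) _.
apply: leq_trans (leq_card_setU _ _) _; rewrite -[2]/(1 + 1).
apply: leq_add; apply/card_le1_eqP => x y; rewrite !inE.
- move=> /andP[xB nx] /andP[yB ny]; apply: val_inj.
  case: (ltngtP x y) => // lt; [case/existsP: ny; exists x|case/existsP: nx; exists y];
  by rewrite lt !eqB ?eqxx.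
- move=> /andP[xB nx] /andP[yB ny]; apply: val_inj.
  case: (ltngtP x y) => // lt; [case/existsP: nx; exists y|case/existsP: ny; exists x];
  by rewrite lt !eqB ?eqxx.
Qed.

(** Initial segments of [S] are totally ordered by inclusion, hence determined by
    their cardinality. *)
Lemma initial_segment_eq (S A B : {set 'I_n}) :
    A \subset S -> B \subset S ->
    (forall x y : 'I_n, x < y -> x \in S -> y \in A -> x \in A) ->
    (forall x y : 'I_n, x < y -> x \in S -> y \in B -> x \in B) ->
    #|A| = #|B| ->
  A = B.
Proof.
move=> AS BS downA downB eqAB.
have [sAB|] := boolP (A \subset B); first by apply/eqP; rewrite eqEcard sAB eqAB /=.
case/subsetPn => a aA aB; apply/esym/eqP; rewrite eqEcard eqAB leqnn andbT.
apply/subsetP => b bB; case: (ltngtP b a) => [lt|lt|/val_inj-> //].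
- by apply: downA lt _ aA; apply: subsetP BS _ bB.
- by rewrite (downB a b lt _ bB) // in aB; apply: subsetP AS _ aA.
Qed.

End EarlyLate.

(** * Partitions connecting only different intervals *)

(** Evenness excludes [b = 1] and [b = 3], for which the bound could fail. *)
Lemma even_size_le (i r b : nat) :
  i + r = b -> ~~ odd b -> r <= 2 -> b <= 2 * ((b == 2) + i).
Proof.
move=> eqb /even_halfK; move: b./2 => h eqh; case: eqP; rewrite /nat_of_bool; lia.
Qed.

Section Intervals.

Variables d m : nat.
Implicit Types (P Q : {set {set 'I_(2 * d * m)}}) (x y : 'I_(2 * d * m)).

Lemma interval_index_subproof x : x %/ d < 2 * m.
Proof.
have lt := ltn_ord x; have d_gt0 : 0 < d by case: d x lt => [|//] [].
by rewrite ltn_divLR // [ltnRHS]mulnAC.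
Qed.

(** The index of the interval containing [x]. *)
Definition interval_index x : 'I_(2 * m) := Ordinal (interval_index_subproof x).

Lemma mem_J (k : 'I_(2 * m)) x : (x \in J d k) = (interval_index x == k).
Proof.
have lt := ltn_ord x; have d_gt0 : 0 < d by case: d x lt => [|//] [].
rewrite inE -val_eqE /= eqn_leq -[x %/ d <= k]ltnS ltn_divLR // leq_divRL //.
exact: andbC.
Qed.

Lemma interval_index_le x y : x <= y -> interval_index x <= interval_index y.
Proof. exact: leq_div2r. Qed.

Lemma card_J (k : 'I_(2 * m)) : 0 < d -> #|J d k| <= d.
Proof.
move=> d_gt0; pose f x := Ordinal (ltn_pmod x d_gt0).
rewrite -[leqRHS]card_ord -(@card_in_imset _ _ f) ?max_card // => x y.
rewrite !mem_J -!val_eqE /= => /eqP xk /eqP yk /(congr1 val) /= eqm.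
by apply: val_inj => /=; rewrite (divn_eq x d) (divn_eq y d) xk yk eqm.
Qed.

Lemma connects_pblock_eq P x y :
    partition P [set: _] -> connects_different_intervals P ->
    pblock P x = pblock P y -> interval_index x = interval_index y ->
  x = y.
Proof.
move=> pP cP eqB eqI; apply/eqP/negP => /negP neq.
have /forall_inP/(_ _ (pblock_memT x pP))/forallP/(_ (interval_index x)) := cP.
move/forall_inP/(_ x); rewrite mem_J eqxx => /(_ isT)/forall_inP/(_ y).
by rewrite mem_J eqI eqxx neq mem_pblockT // eqB mem_pblockT // => /(_ isT).
Qed.

Section OnePartition.

Variable P : {set {set 'I_(2 * d * m)}}.
Hypotheses (pP : partition P [set: _]) (ncP : noncrossing P).
Hypothesis cP : connects_different_intervals P.

(** Within an interval, every early point comes no later than every late one: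
    otherwise the two blocks would cross. *)
Lemma early_le_late x y :
  interval_index x = interval_index y -> early P y -> late P x -> y <= x.
Proof.
move=> eqI /existsP[b /andP[lt_by /eqP eqb]] /existsP[a /andP[lt_xa /eqP eqa]].
rewrite leqNgt; apply/negP => xy.
have bx : b < x.
  rewrite ltnNge; apply/negP => xb.
  have eqIb : interval_index b = interval_index y.
    apply/val_inj/anti_leq/andP; split; first exact/interval_index_le/ltnW.
    by rewrite -eqI; apply: interval_index_le.
  by have eby := connects_pblock_eq pP cP eqb eqIb; rewrite eby ltnn in lt_by.
have ya : y < a.
  rewrite ltnNge; apply/negP => ay.
  have eqIa : interval_index a = interval_index x.
    apply/val_inj/anti_leq/andP; split; last exact/interval_index_le/ltnW.
    by rewrite eqI; apply: interval_index_le.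
  by have eax := connects_pblock_eq pP cP eqa eqIa; rewrite eax ltnn in lt_xa.
have eqbx : pblock P b = pblock P x by apply: (@noncrossing_pblock _ P b x y a).
have exy : x = y by apply: (connects_pblock_eq pP cP) => //; rewrite -eqbx eqb.
by rewrite exy ltnn in xy.
Qed.

Lemma interior_points_inj :
  {in interior_points P &, injective interval_index}.
Proof.
move=> x y; rewrite !inE => /andP[Lx Rx] /andP[Ly Ry] eqI.
by apply/val_inj/anti_leq; rewrite !early_le_late.
Qed.

(** The first interval has no interior point, having no early one. *)
Lemma card_interior_points : 0 < m -> #|interior_points P| < 2 * m.
Proof.
move=> m_gt0; have m2_gt0 : 0 < 2 * m by rewrite muln_gt0.
pose k0 := Ordinal m2_gt0.
rewrite -(card_in_imset interior_points_inj) -[ltnRHS]card_ord -cardsT.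
apply: proper_card; rewrite properE subsetT /=; apply/subsetPn; exists k0 => //.
apply/imsetP => -[x]; rewrite inE => /andP[/existsP[y /andP[yx /eqP eqy]] _] eqk.
have eqI : interval_index y = interval_index x.
  apply/val_inj/anti_leq; rewrite interval_index_le ?(ltnW yx) //=.
  by move/(congr1 val): eqk => /= <-.
by rewrite (connects_pblock_eq pP cP eqy eqI) ltnn in yx.
Qed.

Lemma card_pairs : even_blocks P -> 0 < m ->
  d * m < #|[set B in P | #|B| == 2]| + 2 * m.
Proof.
move=> evP m_gt0; have lt_int := card_interior_points m_gt0.
have sum_blocks : 2 * d * m = \sum_(B in P) #|B|.
  by rewrite -(card_partition pP) cardsT card_ord.
have sum_int : #|interior_points P| = \sum_(B in P) #|B :&: interior_points P|.
  transitivity (\sum_(x in [set: 'I_(2 * d * m)] | x \in interior_points P) 1).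
    by rewrite -sum1_card; apply: eq_bigl => x; rewrite in_setT.
  rewrite (set_partition_big_cond _ pP); apply: eq_bigr => B _.
  by rewrite -sum1_card; apply: eq_bigl => x; rewrite in_setI.
have sum_pairs : #|[set B in P | #|B| == 2]| = \sum_(B in P) (#|B| == 2).
  by rewrite -sum1_card big_mkcond [RHS]big_mkcond; apply: eq_bigr => B _;
    rewrite inE; case: (B \in P); case: (#|B| == 2).
have : 2 * d * m <= 2 * (#|[set B in P | #|B| == 2]| + #|interior_points P|).
  rewrite {1}sum_blocks sum_int sum_pairs -big_split big_distrr /=.
  apply: leq_sum => B BP.
  have evB : ~~ odd #|B| by move/forall_inP: evP; apply.
  have := card_block_noninterior pP BP.
  exact: even_size_le (cardsID (interior_points P) B) evB.
by lia.
Qed.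

(** The early points of the interval of index [k]. *)
Definition early_in P (k : 'I_(2 * m)) := [set x in J d k | early P x].

Lemma early_in_down (k : 'I_(2 * m)) x y : even_blocks P ->
  x < y -> x \in J d k -> y \in early_in P k -> x \in early_in P k.
Proof.
move=> evP lt xk /setIdP[yk Ly]; apply/setIdP; split=> //.
case/orP: (even_early_or_late x pP evP) => // Rx.
suff : y <= x by rewrite leqNgt lt.
by apply: early_le_late => //; move: xk yk; rewrite !mem_J => /eqP-> /eqP->.
Qed.

End OnePartition.

(** The sets of early and of late points, encoded by the number of early points of
    each interval and the presence of an interior point there. *)
Definition early_late_code P : {ffun 'I_(2 * m) -> 'I_d.+1 * bool} :=
  [ffun k => (inord #|early_in P k|,
              [exists x in J d k, x \in interior_points P])].

Lemma early_late_code_early P Q : 0 < d -> P \in NC d m -> Q \in NC d m ->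
  early_late_code P = early_late_code Q -> early P =1 early Q.
Proof.
move=> d_gt0; rewrite !in_set => /and4P[pP ncP evP cP] /and4P[pQ ncQ evQ cQ] eqc x.
pose k := interval_index x.
have sub R : early_in R k \subset J d k by apply/subsetP => y /setIdP[].
have small R : #|early_in R k| < d.+1.
  by rewrite ltnS (leq_trans (subset_leq_card (sub R))) ?card_J.
have /setP/(_ x) : early_in P k = early_in Q k.
  apply: (initial_segment_eq (sub P) (sub Q)).
  - by move=> y z; apply: early_in_down.
  - by move=> y z; apply: early_in_down.
  - move/ffunP/(_ k): eqc; rewrite !ffunE => -[/(congr1 val) /=].
    by rewrite !inordK.
by rewrite /early_in 2!in_set mem_J eqxx.
Qed.

Lemma early_late_code_late P Q x : 0 < d -> P \in NC d m -> Q \in NC d m ->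
  early_late_code P = early_late_code Q -> late P x -> late Q x.
Proof.
move=> d_gt0 NCP NCQ eqc Rx.
have eqL := early_late_code_early d_gt0 NCP NCQ eqc.
move: NCP NCQ; rewrite !in_set => /and4P[pP ncP evP cP] /and4P[pQ ncQ evQ cQ].
case/orP: (even_early_or_late x pQ evQ) => // Lx.
(* [x] is interior for [P], so [Q] has an interior point [y] in the same
   interval; both are the last early point of the interval *)
have : [exists y in J d (interval_index x), y \in interior_points Q].
  move/ffunP/(_ (interval_index x)): eqc; rewrite !ffunE => -[_ <-].
  by apply/exists_inP; exists x; rewrite ?mem_J // in_set eqL Lx.
case/exists_inP => y; rewrite mem_J in_set => /eqP eqI /andP[Ly Ry].
have -> // : x = y.
apply/val_inj/anti_leq/andP; split.
- exact: (@early_le_late Q).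
- by apply: (@early_le_late P) => //; rewrite eqL.
Qed.

Lemma early_late_code_inj : 0 < d -> {in NC d m &, injective early_late_code}.
Proof.
move=> d_gt0 P Q NCP NCQ eqc.
have eqL := early_late_code_early d_gt0 NCP NCQ eqc.
have eqR : late P =1 late Q.
  by move=> x; apply/idP/idP; apply: early_late_code_late.
move: NCP NCQ; rewrite !in_set => /and4P[pP ncP _ _] /and4P[pQ ncQ _ _].
exact: noncrossing_eq.
Qed.

Lemma card_NC_le : 0 < d -> #|NC d m| <= (2 * d.+1) ^ (2 * m).
Proof.
move=> d_gt0; rewrite -(card_in_imset (early_late_code_inj d_gt0)).
apply: leq_trans (max_card _) _.
by rewrite card_ffun card_prod card_bool !card_ord mulnC.
Qed.

End Intervals.

Theorem theorem1p13 (d m : nat) (d_ge1 : (1 <= d)%N) (m_ge1 : (1 <= m)%N) :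
  (#|NC d m| < (4 * d + 4) ^ (2 * m))%N /\
  forall P : {set {set 'I_(2 * d * m)}}, P \in NC d m ->
    ((d%:Z - 2) * m%:Z < (#|[set B in P | #|B| == 2%N]|)%:Z)%R.
Proof.
split.
  apply: leq_ltn_trans (card_NC_le m d_ge1) _.
  by rewrite ltn_exp2r; lia.
move=> P; rewrite in_set => /and4P[pP ncP evP cP].
by have := card_pairs pP ncP cP evP m_ge1; lia.
Qed.
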